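(* Let $S\in\mathrm{Sym}^2\mathfrak n$ define a left-invariant symmetric Killing tensor on $N$, with components $S^{\mathfrak v}\in\mathrm{Sym}^2\mathfrak v$, $S^{\rm m}\in\mathfrak z\cdot\mathfrak v$, $S^{\mathfrak z}\in\mathrm{Sym}^2\mathfrak z$. Then $S$ is decomposable if and only if $S^{\mathfrak v}$ is decomposable.
   Context: $\mathfrak n$ is a finite-dimensional real $2$-step nilpotent Lie algebra (non-abelian, with $[[\mathfrak n,\mathfrak n],\mathfrak n]=0$) with an inner product $g$; $N$ is the connected and simply connected Lie group with Lie algebra $\mathfrak n$, endowed with the left-invariant Riemannian metric (also denoted $g$) defined by $g$; $\nabla$ is its Levi-Civita connection. $\mathfrak z$ is the center of $\mathfrak n$ and $\mathfrak v=\mathfrak z^\perp$. Elements of $\mathrm{Sym}^2\mathfrak n$ are identified with $g$-symmetric endomorphisms of $\mathfrak n$ (via $S(x,y)=g(Sx,y)$), and with left-invariant symmetric $2$-tensor fields on $N$. A symmetric $2$-tensor field $S$ is a Killing tensor if $(\nabla_XS)(X,X)=0$ for every vector field $X$. The component $S^{\mathfrak v}$ of a left-invariant Killing tensor $S$ also defines a left-invariant Killing tensor. The decomposition $\mathfrak n=\mathfrak v\oplus\mathfrak z$ induces $\mathrm{Sym}^2\mathfrak n=\mathrm{Sym}^2\mathfrak v\oplus(\mathfrak z\cdot\mathfrak v)\oplus\mathrm{Sym}^2\mathfrak z$: as endomorphisms, elements of $\mathrm{Sym}^2\mathfrak v$ map $\mathfrak v$ to $\mathfrak v$ and vanish on $\mathfrak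 z$, elements of $\mathfrak z\cdot\mathfrak v$ map $\mathfrak v$ to $\mathfrak z$ and $\mathfrak z$ to $\mathfrak v$, and elements of $\mathrm{Sym}^2\mathfrak z$ map $\mathfrak z$ to $\mathfrak z$ and vanish on $\mathfrak v$. A left-invariant symmetric Killing $2$-tensor on $N$ is called decomposable if it is the sum of a parallel symmetric $2$-tensor field and a (real, finite) linear combination of symmetric products $\xi\cdot\eta=\xi\otimes\eta+\eta\otimes\xi$ of Killing vector fields $\xi,\eta$ on $(N,g)$ (not necessarily left-invariant; vectors are identified with covectors via $g$). *)

(* Defs.v *)
From HB Require Import structures.
From mathcomp Require Import all_boot all_order all_algebra sesquilinear.
From mathcomp Require Import boolp classical_sets reals topology normedtype derive.

Set Implicit Arguments.
Unset Strict Implicit.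
Unset Printing Implicit Defensive.

Import Order.TTheory GRing.Theory Num.Theory.
Import numFieldNormedType.Exports.

Local Open Scope classical_set_scope.
Local Open Scope ring_scope.

(* A finite-dimensional real Lie algebra with an inner product is given, after
   the choice of a basis, as the space 'rV[R]_n with a bilinear bracket
   [br : {bilinear E -> E -> E}] and a positive definite symmetric bilinear form
   [g : {dot E for idfun}], where E = 'rV[R]_n. *)

Section LieAlgebra.
Variables (R : realType) (n : nat).
Local Notation E := 'rV[R]_n.
Implicit Types (br : {bilinear E -> E -> E}) (g : {dot E for idfun}).

Record lie_bracket br : Prop := LieBracket {
  lie_alternating : forall x, br x x = 0;
  lie_jacobi : forall x y z,
    br x (br y z) + br y (br z x) + br z (br x y) = 0 }.

Record two_step_nilpotent br : Prop := TwoStepNilpotent {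
  nonabelian : exists x y, br x y <> 0;
  bracket_bracket : forall x y z, br (br x y) z = 0 }.

(* The center z and its orthogonal complement v. *)
Definition zz br : set E := [set x | forall y, br x y = 0].

Definition vv br g : set E := [set x | forall z, zz br z -> g x z = 0].

Implicit Type S : 'End(E).

Definition symmetric_endo g S : Prop := forall x y, g (S x) y = g x (S y).

(* Sym^2 v, z.v and Sym^2 z, as sets of g-symmetric endomorphisms. *)
Definition sym2_v br g : set 'End(E) := [set S | [/\ symmetric_endo g S,
  (forall x, vv br g x -> vv br g (S x)) & (forall z, zz br z -> S z = 0)]].

Definition z_dot_v br g : set 'End(E) := [set S | [/\ symmetric_endo g S,
  (forall x, vv br g x -> zz br (S x)) & (forall z, zz br z -> vv br g (S z))]].

Definition sym2_z br g : set 'End(E) := [set S | [/\ symmetric_endo g S,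
  (forall z, zz br z -> zz br (S z)) & (forall x, vv br g x -> S x = 0)]].

End LieAlgebra.

Section Smooth.
Variables (R : realType) (n : nat) (W : normedModType R).
Local Notation E := 'rV[R]_n.

(* f is Frechet differentiable, and so are its iterated partial derivatives up
   to order k; in particular those of order <= k are continuous. *)
Fixpoint differentiable_upto (k : nat) (f : E -> W) : Prop :=
  (forall p, differentiable f p) /\
  (if k is k'.+1 then forall v, differentiable_upto k' ('D_v f) else True).

Definition smooth (f : E -> W) : Prop := forall k, differentiable_upto k f.

End Smooth.

(* The connected and simply connected Lie group N of a 2-step nilpotent Lie
   algebra n: the exponential map is a diffeomorphism from n onto N, through
   which N becomes the manifold E with the Baker-Campbell-Hausdorff product,
   whose terms of order > 2 vanish.  The tangent spaces are all E, vector
   fields are functions X : E -> E, and covariant 2-tensor fields are functions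
   T, where T p is a form on the tangent space at p. *)

Section LieGroup.
Variables (R : realType) (n : nat).
Local Notation E := 'rV[R]_n.
Variables (br : {bilinear E -> E -> E}) (g : {dot E for idfun}).
Implicit Types (p q u v x : E) (X Y Z xi eta : E -> E) (f : E -> R)
  (T P : E -> E -> E -> R) (S : 'End(E)).

Definition mulN p q : E := p + q + 2^-1 *: br p q.

(* The differential at p of the left translation by the inverse of p, which
   maps the tangent space at p onto the tangent space at the identity. *)
Definition to_id p u : E := 'd (mulN (- p)) p u.

Definition metric p u v : R := g (to_id p u) (to_id p v).

Definition left_invariant_tensor S p u v : R :=
  g (S (to_id p u)) (to_id p v).

Definition vf_bracket X Y : E -> E :=
  fun p => 'D_(X p) Y p - 'D_(Y p) X p.

Record sym2_tensor_field T : Prop := Sym2TensorField {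
  tensor_smooth : forall u v, smooth (fun p => T p u v);
  tensor_linear : forall p v a u1 u2,
    T p (a *: u1 + u2) v = a * T p u1 v + T p u2 v;
  tensor_sym : forall p u v, T p u v = T p v u }.

(* The function (L_X T)(Y, Z), with L the Lie derivative. *)
Definition lie_derivative X T Y Z : E -> R := fun p =>
  'D_(X p) (fun q => T q (Y q) (Z q)) p
  - T p (vf_bracket X Y p) (Z p) - T p (Y p) (vf_bracket X Z p).

Definition killing_field xi : Prop := smooth xi /\
  forall Y Z, smooth Y -> smooth Z ->
    forall p, lie_derivative xi metric Y Z p = 0.

(* xi (x) eta + eta (x) xi, with xi and eta turned into 1-forms by the metric. *)
Definition sym_product xi eta p u v : R :=
  metric p (xi p) u * metric p (eta p) v
  + metric p (eta p) u * metric p (xi p) v.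

Section Connection.
(* nabla X Y stands for the covariant derivative of Y along X. *)
Variable nabla : (E -> E) -> (E -> E) -> (E -> E).

(* The function (nabla_X T)(Y, Z). *)
Definition covariant_derivative X T Y Z : E -> R := fun p =>
  'D_(X p) (fun q => T q (Y q) (Z q)) p
  - T p (nabla X Y p) (Z p) - T p (Y p) (nabla X Z p).

Record affine_connection : Prop := AffineConnection {
  nabla_smooth : forall X Y, smooth X -> smooth Y -> smooth (nabla X Y);
  nabla_linear : forall f X1 X2 Y,
    smooth f -> smooth X1 -> smooth X2 -> smooth Y ->
    forall p, nabla (fun q => f q *: X1 q + X2 q) Y p =
              f p *: nabla X1 Y p + nabla X2 Y p;
  nabla_additive : forall X Y1 Y2, smooth X -> smooth Y1 -> smooth Y2 ->
    forall p, nabla X (fun q => Y1 q + Y2 q) p = nabla X Y1 p + nabla X Y2 p;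
  nabla_leibniz : forall f X Y, smooth f -> smooth X -> smooth Y ->
    forall p, nabla X (fun q => f q *: Y q) p =
              'D_(X p) f p *: Y p + f p *: nabla X Y p }.

Record levi_civita : Prop := LeviCivita {
  lc_connection : affine_connection;
  lc_torsion_free : forall X Y, smooth X -> smooth Y ->
    forall p, nabla X Y p - nabla Y X p = vf_bracket X Y p;
  lc_metric : forall X Y Z, smooth X -> smooth Y -> smooth Z ->
    forall p, covariant_derivative X metric Y Z p = 0 }.

Definition parallel T : Prop := forall X Y Z,
  smooth X -> smooth Y -> smooth Z ->
  forall p, covariant_derivative X T Y Z p = 0.

Definition killing_tensor T : Prop := forall X, smooth X ->
  forall p, covariant_derivative X T X X p = 0.

Definition decomposable T : Prop :=
  exists P (m : nat) (c : 'I_m -> R) (xi eta : 'I_m -> E -> E),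
    [/\ sym2_tensor_field P, parallel P,
        (forall i, killing_field (xi i)), (forall i, killing_field (eta i)) &
        forall p u v, T p u v =
          P p u v + \sum_(i < m) c i * sym_product (xi i) (eta i) p u v].

End Connection.

End LieGroup.

(* Main.v *)
From HB Require Import structures.
Require Import Defs.
From mathcomp Require Import all_boot all_order all_algebra sesquilinear.
From mathcomp Require Import boolp classical_sets functions reals topology normedtype derive.
From mathcomp Require Import lra.

(* For x in n, the Killing condition for S, evaluated on the left-invariant
   field of x, reads g(x, [x, S x]) = 0; comparing the parts of different degree
   in the central component of x gives g(z, [v, S^m z]) = 0 for v in v and z in z.
   Right-invariant fields are Killing, and in the left trivialization the one
   generated by x is x - [p, x] at p.  Let (e_k) be an orthonormal basis of the
   center.  Then S^m + S^z is the sum of the products of the right-invariant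
   fields of e_k and of S^m e_k + S^z e_k / 2: the error, sum_k e_k . [p, S^m e_k],
   is the quadratic form z |-> 2 g(z, [p, S^m z]) on the center, which vanishes.
   Hence S and S^v differ by a combination of products of Killing fields. *)

Set Implicit Arguments.
Unset Strict Implicit.
Unset Printing Implicit Defensive.

Import Order.TTheory GRing.Theory Num.Theory.
Import numFieldNormedType.Exports.

Local Open Scope classical_set_scope.
Local Open Scope ring_scope.

(** * Derivatives of bilinear expressions in finite dimension *)

Section BilinearDerivative.
Variables (R : realType) (n : nat) (W : normedModType R).
Local Notation E := 'rV[R]_n.
Implicit Type b : {bilinear E -> E -> W}.

Lemma bilinear_expand b x y : b x y =
  \sum_(i < n) \sum_(j < n) (x 0 i * y 0 j) *: b (delta_mx 0 i) (delta_mx 0 j).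
Proof.
rewrite {1}(row_sum_delta x) linear_sumlz; apply: eq_bigr => i _.
rewrite linearZl_LR {1}(row_sum_delta y) linear_sumr scaler_sumr.
by apply: eq_bigr => j _; rewrite linearZr_LR scalerA.
Qed.

(** In coordinates, [b] is a finite sum of products of coordinate functions. The derivative formula
    for a bilinear map requires this joint continuity. *)
Lemma bilinear_continuous b : continuous (fun p : E * E => b p.1 p.2).
Proof.
rewrite (_ : (fun p => _) = fun p : E * E => \sum_(i < n) \sum_(j < n)
    (p.1 0 i * p.2 0 j) *: b (delta_mx 0 i) (delta_mx 0 j)); last first.
  by apply/funext => p; rewrite bilinear_expand.
apply: (continuous_big (P := xpredT)) => [|i _]; first exact: add_continuous.
apply: (continuous_big (P := xpredT)) => [|j _]; first exact: add_continuous.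
move=> p; apply: cvgZr_tmp; apply: cvgM.
- apply: (@continuous_comp _ _ _ fst (fun x : E => x 0 i)); first exact: cvg_fst.
  exact: coord_continuous.
- apply: (@continuous_comp _ _ _ snd (fun x : E => x 0 j)); first exact: cvg_snd.
  exact: coord_continuous.
Qed.

Lemma derive_bilinear b (V : normedModType R) (F G : V -> E) p u :
  differentiable F p -> differentiable G p ->
  differentiable (fun q => b (F q) (G q)) p /\
  'D_u (fun q => b (F q) (G q)) p = b ('D_u F p) (G p) + b (F p) ('D_u G p).
Proof.
move=> dF dG.
have dFG := differentiable_pair dF dG.
have db := differentiable_bilin (F p, G p) (@bilinear_continuous b).
have dc := differentiable_comp dFG db.
split; first exact: dc.
have eqd : 'd (fun q => b (F q) (G q)) p =
    'd (fun r => b r.1 r.2) (F p, G p) \o 'd (fun q => (F q, G q)) p :> (V -> W).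
  exact: diff_comp dFG db.
rewrite (deriveE u dc) (deriveE u dF) (deriveE u dG) eqd /=.
rewrite (diff_bilin _ (@bilinear_continuous b)) (diff_pair dF dG) /=.
exact: addrC.
Qed.

End BilinearDerivative.

Section Smooth.
Variables (R : realType) (n : nat) (W : normedModType R).
Local Notation E := 'rV[R]_n.
Implicit Type f : E -> W.

Lemma smooth_differentiable f p : smooth f -> differentiable f p.
Proof. by move=> /(_ 0) [+ _]; exact. Qed.

Lemma smooth_cst (w : W) : smooth (cst w : E -> W).
Proof.
move=> k; elim: k w => [|k IHk] w; split=> // v.
by rewrite (_ : 'D_v _ = cst 0) //; apply/funext => p; rewrite derive_cst.
Qed.

(** The first directional derivatives are constant, so [smooth_cst] takes care of all higher
    ones. *)
Lemma smooth_affine f : (forall p, differentiable f p) ->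
  (forall v, exists w, 'D_v f = cst w) -> smooth f.
Proof.
move=> df Df [|k]; split=> // v.
by have [w ->] := Df v; exact: smooth_cst.
Qed.

End Smooth.

(* The family is orthonormal; the expansion property is all that is used. *)
Lemma reproducing_family (R : rcfType) (U : vectType R)
    (g : {dot U for idfun}) (V : {vspace U}) :
  exists m (e : 'I_m -> U), (forall i, e i \in V) /\
    (forall x, x \in V -> x = \sum_(i < m) g x (e i) *: e i).
Proof.
suff [e [eV xe]] : exists e : seq U, {in e, forall y, y \in V} /\
    (forall x, x \in V -> x = \sum_(y <- e) g x y *: y).
  exists (size e), (tnth (in_tuple e)); split=> [i|x /xe {1}->].
    by apply: eV; apply: mem_tnth.
  by rewrite big_tnth.
(* Gram-Schmidt, by induction on a list spanning [V]: [pv] is the projection of the new vector [v]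
   onto the span of the earlier ones. *)
rewrite -(span_basis (vbasisP V)); elim: (tval (vbasis V)) => [|v s [e [es xe]]].
  by exists [::]; split=> // x; rewrite span_nil memv0 big_nil => /eqP.
have ss y : y \in <<s>>%VS -> y \in <<v :: s>>%VS.
  by move=> ys; rewrite span_cons -[y]add0r memv_add ?mem0v.
pose pv := \sum_(y <- e) g v y *: y; pose v' := v - pv.
have pvs : pv \in <<s>>%VS.
  by rewrite /pv big_seq; apply: rpred_sum => y ye; apply/rpredZ/es.
have gC x y : g x y = g y x by rewrite hermC expr0 mul1r.
have v'e y : y \in <<s>>%VS -> g v' y = 0.
  move=> ys; rewrite /v' linearBl /pv linear_sumlz /=.
  rewrite [in g v y](xe y ys) linear_sumr -sumrB big1//= => z _.
  by rewrite linearZl_LR linearZr_LR/= [g z y]gC mulrC subrr.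
(* The induction does not remember that the list is free, so [v] may already lie in the span of [s];
   the family is then kept unchanged. *)
have [v'0|v'0] := eqVneq v' 0.
  exists e; split=> [y /es/ss//|x]; rewrite span_cons.
  move=> /memv_addP[_ /vlineP[a ->] [y ys ->]].
  apply/xe/rpredD => //; apply: rpredZ; rewrite -(subrK pv v) -/v' v'0 add0r.
  exact: pvs.
have v'gt0 := @neq0_dnorm_gt0 _ _ _ g v' v'0.
pose r := Num.sqrt (g v' v'); have r2 : r * r = g v' v'.
  by rewrite -expr2 sqr_sqrtr// ltW.
have r0 : r != 0 by rewrite sqrtr_eq0 -ltNge.
pose w := r^-1 *: v'.
have v's : v' \in <<v :: s>>%VS.
  by apply: rpredB; [exact/memv_span/mem_head | exact: ss].
have gww : g w w = 1.
  rewrite linearZl_LR linearZr_LR/= -[RHS](mulfV r0) -[X in _ = X / _](mulKf r0).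
  by rewrite r2 /= mulrCA mulrC.
have gwy y : y \in <<s>>%VS -> g w y = 0.
  by move=> ys; rewrite linearZl_LR/= v'e ?mulr0.
exists (w :: e); split=> [y|x].
  by rewrite inE => /predU1P[->|/es/ss//]; rewrite rpredZ.
rewrite span_cons => /memv_addP[_ /vlineP[a ->] [y ys ->]].
have -> : a *: v + y = (a * r) *: w + (a *: pv + y).
  by rewrite scalerA mulfK// addrA -scalerDr subrK.
set y' := a *: pv + y; have y's : y' \in <<s>>%VS by rewrite rpredD ?rpredZ.
rewrite big_cons; congr (_ + _).
  by rewrite linearDl linearZl_LR/= gww mulr1 [g y' _]gC gwy// addr0.
rewrite [LHS]xe//; apply: eq_big_seq => z ze.
by rewrite [in RHS]linearDl [in RHS]linearZl_LR/= gwy ?es// mulr0 add0r.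
Qed.

(** * The left trivialization and the invariant vector fields *)

Section LieGroup.
Variables (R : realType) (n : nat).
Local Notation E := 'rV[R]_n.
Variables (br : {bilinear E -> E -> E}) (g : {dot E for idfun}).
Hypotheses (br_lie : lie_bracket br) (br_two_step : two_step_nilpotent br).

Lemma brC x y : br x y = - br y x.
Proof.
have := lie_alternating br_lie (x + y).
rewrite linearDl !linearDr !(lie_alternating br_lie) add0r addr0 => /eqP.
by rewrite addr_eq0 => /eqP.
Qed.

Lemma br_brl x y z : br (br x y) z = 0.
Proof. exact: bracket_bracket. Qed.

Lemma br_brr x y z : br x (br y z) = 0.
Proof. by rewrite brC br_brl oppr0. Qed.

Lemma dotC x y : g x y = g y x.
Proof. by rewrite hermC expr0 mul1r. Qed.

(** The map [mulN (- p)] is affine, with linear part the identity minus half the bracket with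
    [p]. *)
Lemma to_idE p u : to_id br p u = u - 2^-1 *: br p u.
Proof.
have did : differentiable (id : E -> E) p by exact: ex_diff.
have [db Db] := derive_bilinear br u (differentiable_cst (- p) p) did.
have ds := differentiableZ 2^-1 db.
have dt := differentiableD (differentiable_cst (- p) p) did.
have dtE : 'D_u (cst (- p) + id : E -> E) p = u.
  by rewrite deriveD ?derive_cst ?derive_id ?add0r//; exact: diff_derivable.
rewrite /to_id (_ : mulN br (- p) =
  (cst (- p) + id) + 2^-1 *: (fun q => br (- p) q)) //.
rewrite -deriveE; last exact: (differentiableD dt ds).
rewrite deriveD ?deriveZ; try exact: diff_derivable.
by rewrite Db dtE derive_cst derive_id linear0l add0r linearNl scalerN.
Qed.

(** The derivatives at [q = 0] in direction [x] of [mulN p q] and of [mulN q p]: the left- and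
    right-invariant fields with value [x] at the identity. *)
Definition left_field x p : E := x + 2^-1 *: br p x.
Definition right_field x p : E := x - 2^-1 *: br p x.

Lemma to_id_left_field x p : to_id br p (left_field x p) = x.
Proof.
rewrite to_idE /left_field linearDr linearZr_LR /= br_brr scaler0 addr0.
by rewrite addrK.
Qed.

Lemma to_id_right_field x p : to_id br p (right_field x p) = x - br p x.
Proof.
rewrite to_idE /right_field linearBr linearZr_LR /= br_brr scaler0 subr0.
rewrite -addrA -opprD -scalerDl (_ : 2^-1 + 2^-1 = 1) ?scale1r//; lra.
Qed.

Lemma derive_affine x a p u :
  differentiable (fun q => x + a *: br q x) p /\
  'D_u (fun q => x + a *: br q x) p = a *: br u x.
Proof.
have did : differentiable (id : E -> E) p by exact: ex_diff.
have [db Db] := derive_bilinear br u did (differentiable_cst x p).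
have ds := differentiableZ a db.
have dc := differentiable_cst x p.
split; first exact: (differentiableD dc ds).
rewrite (_ : (fun q => _) = cst x + a *: (fun q => br q x)) //.
rewrite deriveD ?deriveZ; try exact: diff_derivable.
by rewrite Db derive_cst derive_id linear0r add0r addr0.
Qed.

Lemma smooth_affine_field x a : smooth (fun q => x + a *: br q x).
Proof.
apply: smooth_affine => [p|v]; first by have [] := derive_affine x a p 0.
by exists (a *: br v x); apply/funext => p; have [] := derive_affine x a p v.
Qed.

Lemma smooth_left_field x : smooth (left_field x).
Proof. exact: smooth_affine_field. Qed.

Lemma right_fieldE x : right_field x = fun q => x + (- 2^-1) *: br q x.
Proof. by apply/funext => q; rewrite scaleNr. Qed.

Lemma smooth_right_field x : smooth (right_field x).
Proof. by rewrite right_fieldE; exact: smooth_affine_field. Qed.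

Lemma derive_metric (Y Z : E -> E) p u : differentiable Y p -> differentiable Z p ->
  'D_u (fun q => metric br g q (Y q) (Z q)) p =
  g ('D_u Y p - 2^-1 *: (br u (Y p) + br p ('D_u Y p))) (to_id br p (Z p)) +
  g (to_id br p (Y p)) ('D_u Z p - 2^-1 *: (br u (Z p) + br p ('D_u Z p))).
Proof.
move=> dY dZ.
(* [g] is repackaged as a bilinear map to [R] so that [derive_bilinear] applies to it. *)
have glin : bilinear_for (GRing.Scale.Law.clone _ _ *:%R _)
    (GRing.Scale.Law.clone _ _ *:%R _) (g : E -> E -> R).
  split=> [y|x] a x1 x2 /=; first by rewrite linearPl.
  by rewrite linearPr.
pose gB : {bilinear E -> E -> R} := HB.pack (g : E -> E -> R)
  (bilinear_isBilinear.Build R E E R _ _ (g : E -> E -> R) glin).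
have dto (X : E -> E) : differentiable X p ->
    differentiable (fun q => to_id br q (X q)) p /\
    'D_u (fun q => to_id br q (X q)) p =
      'D_u X p - 2^-1 *: (br u (X p) + br p ('D_u X p)).
  move=> dX.
  have did : differentiable (id : E -> E) p by exact: ex_diff.
  have [db Db] := derive_bilinear br u did dX.
  have ds := differentiableZ 2^-1 db.
  rewrite (_ : (fun q => to_id _ _ _) = X - 2^-1 *: (fun q => br q (X q))).
    split; first exact: (differentiableB dX ds).
    rewrite deriveB ?deriveZ; try exact: diff_derivable.
    by rewrite Db derive_id.
  by apply/funext => q; rewrite to_idE.
have [dY' DY'] := dto Y dY; have [dZ' DZ'] := dto Z dZ.
have [_] := derive_bilinear gB u dY' dZ'.
by rewrite DY' DZ'.
Qed.

(** The flow of a right-invariant field consists of left translations, which are isometries. The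
    proof checks this infinitesimally, by matching the bracket terms with the product rule of
    [derive_metric]. *)
Lemma killing_right_field x : killing_field br g (right_field x).
Proof.
split=> [|Y Z sY sZ p]; first exact: smooth_right_field.
rewrite /lie_derivative derive_metric; [|exact: smooth_differentiable..].
(* The right-hand side is the derivative, along the right-invariant field, of the trivialized field
   [to_id br q (X q)], in the form produced by [derive_metric]. *)
have to_id_bracket (X : E -> E) :
    to_id br p (vf_bracket (right_field x) X p) =
    'D_(right_field x p) X p
      - 2^-1 *: (br (right_field x p) (X p) + br p ('D_(right_field x p) X p)).
  rewrite to_idE /vf_bracket.
  have -> : 'D_(X p) (right_field x) p = - 2^-1 *: br (X p) x.
    by rewrite right_fieldE; have [] := derive_affine x (- 2^-1) p (X p).
  rewrite scaleNr opprK linearDr linearZr_LR /= br_brr scaler0 addr0.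
  rewrite [X in br X (_ p)]/right_field linearBl linearZl_LR /= br_brl.
  rewrite scaler0 subr0 [br (X p) x]brC scalerN.
  by rewrite scalerDr opprD addrA.
(* Rewriting with to_id_bracket directly makes unification diverge. *)
have eY : metric br g p (vf_bracket (right_field x) Y p) (Z p) =
  g _ (to_id br p (Z p)) := congr1 (g ^~ (to_id br p (Z p))) (to_id_bracket Y).
have eZ : metric br g p (Y p) (vf_bracket (right_field x) Z p) =
  g (to_id br p (Y p)) _ := congr1 (g (to_id br p (Y p))) (to_id_bracket Z).
rewrite eY eZ -addrA -opprD.
exact: addrN.
Qed.

Lemma to_idB p u v : to_id br p (u - v) = to_id br p u - to_id br p v.
Proof.
by rewrite !to_idE linearBr scalerBr !opprD !opprK addrACA.
Qed.

Lemma vf_bracket_left_field x y p :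
  vf_bracket (left_field x) (left_field y) p = br x y.
Proof.
have D u z : 'D_u (left_field z) p = 2^-1 *: br u z.
  by have [] := derive_affine z 2^-1 p u.
rewrite /vf_bracket !D /left_field !linearDl !linearZl_LR /= !br_brl.
rewrite !scaler0 !addr0 [br y x]brC scalerN opprK -scalerDl.
by rewrite (_ : 2^-1 + 2^-1 = 1) ?scale1r//; lra.
Qed.

(** * The Killing condition on left-invariant fields *)

Section KillingCondition.
Variables (nabla : (E -> E) -> (E -> E) -> E -> E) (S : 'End(E)).
Hypotheses (nablaLC : levi_civita br g nabla) (S_sym : symmetric_endo g S).

Lemma derive_invariant (T : E -> E -> E -> R) (B : E -> E -> R) x y p u :
  (forall q v w, T q v w = B (to_id br q v) (to_id br q w)) ->
  'D_u (fun q => T q (left_field x q) (left_field y q)) p = 0.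
Proof.
move=> TB; rewrite (_ : (fun q => _) = cst (B x y)) ?derive_cst//.
by apply/funext => q; rewrite TB !to_id_left_field.
Qed.

(** Tensors are constant on left-invariant fields, so only connection terms remain. The Killing
    condition gives g(S x, nabla_X X) = 0, metric compatibility turns this into g(x, nabla_X Y) = 0
    and also gives g(x, nabla_Y X) = 0; the torsion identity subtracts the two. *)
Lemma killing_tensor_bracket :
  killing_tensor nabla (left_invariant_tensor br g S) ->
  forall x, g x (br x (S x)) = 0.
Proof.
move=> SK x; pose X := left_field x; pose Y := left_field (S x).
have sX : smooth X by exact: smooth_left_field.
have sY : smooth Y by exact: smooth_left_field.
have := SK X sX 0; rewrite /covariant_derivative.
rewrite (@derive_invariant _ (fun u v => g (S u) v)) //.
have := lc_metric nablaLC sX sX sY 0; rewrite /covariant_derivative.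
rewrite (@derive_invariant _ (fun u v => g u v)) //.
have := lc_metric nablaLC sY sX sX 0; rewrite /covariant_derivative.
rewrite (@derive_invariant _ (fun u v => g u v)) //.
have := congr1 (to_id br 0) (lc_torsion_free nablaLC sX sY 0).
rewrite vf_bracket_left_field to_idB [RHS]to_idE br_brr scaler0 subr0.
rewrite /metric /left_invariant_tensor !to_id_left_field => <-.
rewrite linearBr /= [g _ x]dotC S_sym [g (S x) _]dotC.
lra.
Qed.

End KillingCondition.

Lemma zz_br x y : zz br (br x y).
Proof. by move=> z; rewrite br_brl. Qed.

Lemma zzP z : zz br z -> forall y, br y z = 0.
Proof. by move=> zz y; rewrite brC zz oppr0. Qed.

Lemma center_family : exists m (e : 'I_m -> E), (forall i, zz br (e i)) /\
  (forall z, zz br z -> z = \sum_(i < m) g z (e i) *: e i).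
Proof.
(* The adjoint representation in coordinates: its kernel presents the center as a subspace, to which
   [reproducing_family] applies. *)
pose f x : 'M[R]_n := \matrix_(i, j) br x (delta_mx 0 i) 0 j.
have flin : linear f.
  by move=> a x y; apply/matrixP => i j; rewrite !mxE linearPl !mxE.
pose F : {linear E -> 'M[R]_n} :=
  HB.pack f (GRing.isLinear.Build _ _ _ _ f flin).
have kerP z : reflect (zz br z) (z \in lker (linfun F)).
  rewrite memv_ker lfunE /=; apply: (iffP eqP) => [fz y|zz].
    rewrite (row_sum_delta y) linear_sumr big1//= => i _.
    rewrite linearZr_LR/= (_ : br z _ = 0) ?scaler0//.
    by apply/rowP => j; have /matrixP/(_ i j) := fz; rewrite !mxE.
  by apply/matrixP => i j; rewrite !mxE zz mxE.
have [m [e [eK Ke]]] := reproducing_family g (lker (linfun F)).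
by exists m, e; split=> [i|z /kerP/Ke//]; apply/kerP.
Qed.

(** * The mixed and central components as products of Killing fields *)

Section Decomposition.
Variables (Sv Sm Sz : 'End(E)).
Hypotheses (Sv_v : sym2_v br g Sv) (Sm_m : z_dot_v br g Sm)
  (Sz_z : sym2_z br g Sz).
Hypothesis S_bracket : forall x, g x (br x ((Sv + Sm + Sz) x)) = 0.

Lemma mixed_bracket x z : vv br g x -> zz br z -> g z (br x (Sm z)) = 0.
Proof.
case: Sv_v Sm_m Sz_z => [_ _ Svz] [_ Smv Smz] [_ Szz Szv] xv zz.
(* Expanding [S_bracket] at [x + t *: z] leaves a polynomial in [t]; adding its values at 1 and -1
   isolates the quadratic coefficient. *)
have Q t : t * g z (br x (Sv x)) + t * (t * g z (br x (Sm z))) = 0.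
  have := S_bracket (x + t *: z).
  have -> : br (x + t *: z) ((Sv + Sm + Sz) (x + t *: z)) =
      br x (Sv x) + t *: br x (Sm z).
    have lin (T : 'End(E)) : T (x + t *: z) = T x + t *: T z.
      by rewrite linearD linearZ.
    rewrite !add_lfunE !lin (Svz z zz) (Szv x xv) scaler0 addr0 add0r.
    rewrite linearDl linearZl_LR /= zz scaler0 addr0 !linearDr !linearZr_LR /=.
    by rewrite (zzP (Smv _ xv)) (zzP (Szz _ zz)) scaler0 addr0 add0r.
  rewrite linearDl linearZl_LR !linearDr !linearZr_LR /=.
  by rewrite !xv ?mulr0 ?add0r ?mulrDr//; exact: zz_br.
have := Q 1; have := Q (-1); lra.
Qed.

(** The two summands of the symmetric product yield the two off-diagonal blocks of [Sm] once each,
    but both yield [Sz]; hence the factor one half on [Sz] only. *)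
Lemma mixed_tensor p u v m (e : 'I_m -> E) : (forall i, zz br (e i)) ->
  (forall z, zz br z -> z = \sum_(i < m) g z (e i) *: e i) ->
  left_invariant_tensor br g (Sm + Sz) p u v =
  \sum_(i < m) sym_product br g (right_field (e i))
    (right_field ((Sm + 2^-1 *: Sz) (e i))) p u v.
Proof.
move=> ez ze; rewrite /left_invariant_tensor /sym_product /metric.
set U := to_id br p u; set V := to_id br p v.
pose A := Sm + 2^-1 *: Sz; pose P x := A x - br p (A x).
(* The orthogonal projection onto the center; [sumP] collapses sums over the family through it. *)
pose pi x : E := \sum_(i < m) g x (e i) *: e i.
have piz x : zz br (pi x).
  by move=> y; rewrite linear_sumlz big1//= => i _; rewrite linearZl_LR/= ez scaler0.
have piv x : vv br g (x - pi x).
  move=> z zz; rewrite linearBl /= linear_sumlz [in g x z](ze z zz) linear_sumr.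
  rewrite -sumrB big1// => i _.
  by rewrite linearZl_LR linearZr_LR/= [g (e i) z]dotC mulrC subrr.
have sumP x y : \sum_(i < m) g (e i) x * g (P (e i)) y = g (P (pi x)) y.
  rewrite /P /pi [A (\sum_(i < m) _)]linear_sum linear_sumr /= -sumrB linear_sumlz.
  apply: eq_bigr => i _; rewrite linearZ linearZr_LR /= -scalerBr linearZl_LR /=.
  by rewrite [g x _]dotC.
under eq_bigr => i _ do
  rewrite !to_id_right_field (zzP (ez i)) subr0 -/A -/(P (e i)) [X in _ + X]mulrC.
rewrite big_split /= !sumP.
case: Sv_v Sm_m Sz_z => [_ _ Svz] [Sms Smv Smz] [Szs Szz Szv].
have lfunD (T : 'End(E)) a b : T (a + b) = T a + T b by rewrite linearD.
(* Polarization of [mixed_bracket] in its central argument; [x] becomes arbitrary because its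
   central part brackets to zero. *)
have mix x z z' : zz br z -> zz br z' ->
    g z (br x (Sm z')) + g z' (br x (Sm z)) = 0.
  move=> hz hz'; have [w wv brw] : exists2 w, vv br g w & br x = br w :> (E -> E).
    by exists (x - pi x) => //; apply/funext => y; rewrite linearBl /= piz subr0.
  have hzz' : zz br (z + z') by move=> y; rewrite linearDl /= hz hz' addr0.
  rewrite !brw; have := mixed_bracket wv hzz'.
  rewrite lfunD linearDl !linearDr /=.
  by rewrite !mixed_bracket// addr0 add0r.
have split_v w : exists x, vv br g x /\ w = x + pi w.
  by exists (w - pi w); rewrite subrK.
have [x [xv]] := split_v U; have [y [yv]] := split_v V.
move: (pi U) (pi V) (piz U) (piz V) => z t hz ht -> ->.
have vz a b : vv br g a -> zz br b -> g a b = 0 by exact.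
have zv a b : zz br a -> vv br g b -> g a b = 0 by rewrite dotC => *; exact: vz.
have AE b : zz br b -> P b = Sm b + 2^-1 *: Sz b - br p (Sm b).
  move=> hb; rewrite /P /A add_lfunE scale_lfunE linearDr linearZr_LR /=.
  by rewrite (zzP (Szz _ hb)) scaler0 addr0.
rewrite !AE// add_lfunE !lfunD (Szv x xv) add0r.
rewrite !(linearDl, linearBl, linearDr, linearBr, linearZl_LR) /=.
rewrite !(zv (Sm x) y) ?(vz (Sm z) t) ?(zv (Sz z) y) ?(vz (Sm t) z) ?(zv (Sz t) x)//;
  try by [exact: Smv|exact: Smz|exact: Szz].
rewrite !linearNl /= (zv _ _ (zz_br _ _) xv) (zv _ _ (zz_br _ _) yv).
have -> : g (Sm t) x = g (Sm x) t by rewrite Sms dotC.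
have -> : g (Sz t) z = g (Sz z) t by rewrite Szs dotC.
(* After orthogonality and symmetry of the blocks, the only error left is the pair of bracket terms
   at [p], which [mix] cancels. *)
have := mix p z t hz ht; rewrite [g z _]dotC [g t _]dotC.
lra.
Qed.

End Decomposition.

Lemma decomposable_add nabla T T' m (c : 'I_m -> R) (xi eta : 'I_m -> E -> E) :
  (forall i, killing_field br g (xi i)) ->
  (forall i, killing_field br g (eta i)) ->
  (forall p u v, T' p u v =
    T p u v + \sum_(i < m) c i * sym_product br g (xi i) (eta i) p u v) ->
  decomposable br g nabla T -> decomposable br g nabla T'.
Proof.
move=> kxi keta T'E [P [m' [c' [xi' [eta' [sP pP kxi' keta' TE]]]]]].
(* Concatenates the two finite families, so that the parallel part [P] is kept and only the sum of
   products grows. *)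
pose glue A (a : 'I_m' -> A) (b : 'I_m -> A) (i : 'I_(m' + m)) :=
  match fintype.split i with inl j => a j | inr j => b j end.
have gluel A (a : 'I_m' -> A) b i : glue A a b (lshift m i) = a i.
  by rewrite /glue (unsplitK (inl i)).
have gluer A (a : 'I_m' -> A) b i : glue A a b (rshift m' i) = b i.
  by rewrite /glue (unsplitK (inr i)).
exists P, (m' + m)%N, (glue _ c' c), (glue _ xi' xi), (glue _ eta' eta).
split=> // [i|i|p u v]; try by rewrite /glue; case: fintype.split.
rewrite T'E TE big_split_ord /= -addrA; congr (_ + (_ + _)); apply: eq_bigr => i _.
  by rewrite !gluel.
by rewrite !gluer.
Qed.

End LieGroup.

Theorem proposition5p5 (R : realType) (n : nat)
  (br : {bilinear 'rV[R]_n -> 'rV[R]_n -> 'rV[R]_n})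
  (g : {dot 'rV[R]_n for idfun})
  (nabla : ('rV[R]_n -> 'rV[R]_n) -> ('rV[R]_n -> 'rV[R]_n) ->
           'rV[R]_n -> 'rV[R]_n)
  (S Sv Sm Sz : 'End('rV[R]_n)) :
  lie_bracket br -> two_step_nilpotent br -> levi_civita br g nabla ->
  symmetric_endo g S ->
  sym2_v br g Sv -> z_dot_v br g Sm -> sym2_z br g Sz -> S = Sv + Sm + Sz ->
  killing_tensor nabla (left_invariant_tensor br g S) ->
  (decomposable br g nabla (left_invariant_tensor br g S) <->
   decomposable br g nabla (left_invariant_tensor br g Sv)).
Proof.
move=> lie nil LC S_sym Svv Smm Szz SE SK.
have SB x := killing_tensor_bracket lie nil LC S_sym SK x.
rewrite SE in SB.
have [m [e [ez ze]]] := center_family br g.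
have TE p u v : left_invariant_tensor br g S p u v =
    left_invariant_tensor br g Sv p u v +
    left_invariant_tensor br g (Sm + Sz) p u v.
  by rewrite /left_invariant_tensor SE -addrA add_lfunE linearDl.
have KR i := killing_right_field g lie nil (e i).
have KA i := killing_right_field g lie nil ((Sm + 2^-1 *: Sz) (e i)).
have mixE p u v := mixed_tensor lie nil Svv Smm Szz SB p u v ez ze.
(* The coefficient -1 removes the products from [S], the coefficient 1 adds them to [Sv]. *)
split; [apply: (@decomposable_add _ _ _ _ _ _ _ _ (fun=> -1) _ _ KR KA)
       |apply: (@decomposable_add _ _ _ _ _ _ _ _ (fun=> 1) _ _ KR KA)] => p u v.
  by rewrite TE mixE -mulr_sumr mulN1r addrK.
by rewrite TE mixE -mulr_sumr mul1r.
Qed.
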